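(* Let $p$ be a positive integer and let $G$ be an $n$-vertex graph such that $K_{p,p}$ is not a subgraph of the complement $\overline{G}$. Then every $2$-edge-coloring of $G$ contains two vertex-disjoint monochromatic paths of distinct colors which together cover at least $n-1000(50p)^p$ vertices.
   Context: $\overline{G}$ denotes the complement of $G$. Convention: the empty graph and a single vertex are accepted as paths of any color, and a single edge is a path in its own color. *)

(* Defs.v *)
From HB Require Import structures.
From mathcomp Require Import all_boot.

Set Implicit Arguments.
Unset Strict Implicit.
Unset Printing Implicit Defensive.

(* Finite simple graphs. *)
Record sgraph := SGraph {
  vert :> finType;
  adj : rel vert;
  adj_sym : symmetric adj;
  adj_irr : irreflexive adj }.

Section Complement.
Variable G : sgraph.

Definition compl_adj : rel G := fun x y => (x != y) && ~~ adj x y.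

Fact compl_adj_sym : symmetric compl_adj.
Proof. by move=> x y; rewrite /compl_adj eq_sym adj_sym. Qed.

Fact compl_adj_irr : irreflexive compl_adj.
Proof. by move=> x; rewrite /compl_adj eqxx. Qed.

Definition compl_graph : sgraph := SGraph compl_adj_sym compl_adj_irr.
End Complement.

Section CompleteBipartite.
Variables m n : nat.

Definition biclique_adj : rel ('I_m + 'I_n)%type := fun x y =>
  match x, y with
  | inl _, inr _ | inr _, inl _ => true
  | _, _ => false
  end.

Fact biclique_adj_sym : symmetric biclique_adj.
Proof. by case=> [i|i] [j|j]. Qed.

Fact biclique_adj_irr : irreflexive biclique_adj.
Proof. by case. Qed.

Definition biclique : sgraph := SGraph biclique_adj_sym biclique_adj_irr.
End CompleteBipartite.

(* Not necessarily induced: some copy of H sits in G. *)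
Definition subgraph (H G : sgraph) : Prop :=
  exists f : H -> G, injective f /\ (forall x y, adj x y -> adj (f x) (f y)).

(* The edge xy is the unordered pair [set x; y]; the values of a coloring at
   sets that are not edges of G are never used. *)
Definition edge_coloring2 (G : sgraph) := {set G} -> bool.

(* Paths are given by their sequences of vertices. [::] and [:: x] qualify for
   both values of k. *)
Definition monochromatic_path (G : sgraph) (c : edge_coloring2 G) (k : bool)
    (s : seq G) : bool :=
  uniq s && sorted (fun x y => adj x y && (c [set x; y] == k)) s.

(* Main.v *)
(** Run depth-first search on the red graph, keeping the stack (a red path), the
    set D of vertices already popped and the set U of unvisited ones: no red
    edge joins D to U. Every step lowers |U| - |D| by exactly one, so at some
    moment |D| = |U|. Every edge of G between D and U is then blue, and
    a second search, in the bipartite blue graph between D and U, stopped at the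
    same kind of moment, leaves fewer than 4p vertices uncovered: the blue
    path alternates between the sides, so the popped vertices on one side and
    the unvisited ones on the other are equinumerous, by parity, and they
    span a hole of G. *)
Require Import Defs.
From HB Require Import structures.
From mathcomp Require Import all_boot zify.

Set Implicit Arguments.
Unset Strict Implicit.
Unset Printing Implicit Defensive.

Section DepthFirstSearch.
Variables (T : finType) (e : rel T).
Hypothesis e_sym : symmetric e.

(* The equation between numbers of memberships says that s, D and U
   partition S. *)
Definition dfs_state (S : {set T}) (s : seq T) (D U : {set T}) : Prop :=
  [/\ uniq s, sorted e s,
      forall x, (x \in s) + (x \in D) + (x \in U) = (x \in S)
    & {in D & U, forall x y, ~~ e x y}].

(** Induction on the gap [k]: pushing an unvisited vertex shrinks [U], popping the top enlarges [D],
    so either move lowers the gap by one. The head of [s] is the top of the stack. *)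
Lemma dfs_balance (S : {set T}) k s (D U : {set T}) :
    dfs_state S s D U -> #|U| = #|D| + k ->
  exists s' (D' U' : {set T}), dfs_state S s' D' U' /\ #|D'| = #|U'|.
Proof.
elim: k s D U => [|k IHk] s D U [Us Es part noDU] cardU.
  by exists s, D, U; split; rewrite ?cardU ?addn0.
have push y : y \in U -> sorted e (y :: s) ->
    exists s' (D' U' : {set T}), dfs_state S s' D' U' /\ #|D'| = #|U'|.
  move=> Uy Eys; apply: (IHk (y :: s) D (U :\ y)); last first.
    by move: cardU; rewrite (cardsD1 y U) Uy; lia.
  split=> //.
  - by rewrite /= Us andbT; have := part y; rewrite Uy; case: (y \in s) => //; lia.
  - move=> x; have := part x; rewrite !inE.
    by case: (eqVneq x y) => [->|_] /=; rewrite ?Uy; lia.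
  - by move=> u v Du /setD1P[_ Uv]; apply: noDU.
case: s Us Es part push => [|x s] Us Es part push.
  (* An empty stack restarts from any unvisited vertex; one exists because the gap is positive. *)
  have /card_gt0P[y Uy] : 0 < #|U| by lia.
  exact: push Uy _.
case: (pickP [pred y in U | e x y]) => [y /andP[Uy exy] | nbr_x].
  by apply: (push y Uy); rewrite /= e_sym exy.
(* The top [x] has no neighbour left in [U], so it can move to [D] without creating an edge from [D]
   to [U]. *)
have part_x := part x; rewrite mem_head in part_x.
apply: (IHk s (x |: D) U); last by rewrite cardsU1 cardU; lia.
have [xNs Us'] := andP Us.
split=> //; first exact: path_sorted Es.
- move=> y; have := part y; rewrite !inE.
  by case: (eqVneq y x) => [->|_] /=; rewrite ?(negPf xNs); lia.
- move=> u v /setU1P[-> | Du] Uv; last exact: noDU.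
  by have := nbr_x v; rewrite /= Uv /= => ->.
Qed.

Lemma balanced_dfs (S : {set T}) :
  exists s (D U : {set T}), dfs_state S s D U /\ #|D| = #|U|.
Proof.
apply: (@dfs_balance S #|S| [::] set0 S); last by rewrite cards0.
by split=> // [x|x y]; rewrite !inE.
Qed.

(** Sum the partition identity over the vertices satisfying [P]. *)
Lemma dfs_card (S : {set T}) s (D U : {set T}) (P : {pred T}) :
    dfs_state S s D U ->
  #|[set x in S | P x]| =
    count P s + #|[set x in D | P x]| + #|[set x in U | P x]|.
Proof.
move=> [Us _ part _].
have -> : count P s = #|[set x in s | P x]|.
  rewrite -size_filter -(card_uniqP (filter_uniq P Us)).
  by apply: eq_card => x; rewrite inE mem_filter andbC.
have card_sum (A : {pred T}) :
    #|[set x in A | P x]| = \sum_x ((x \in A) && P x).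
  by rewrite -sum1dep_card big_mkcond; apply: eq_bigr => x _; case: (_ && _).
rewrite !card_sum -!big_split; apply: eq_bigr => x _ /=; have := part x.
by case: (P x); rewrite ?andbF ?andbT.
Qed.

End DepthFirstSearch.

Lemma alternating_count (T : Type) (a : pred T) (s : seq T) :
    sorted (fun x y => a x != a y) s ->
  count a s <= (count (predC a) s).+1 /\ count (predC a) s <= (count a s).+1.
Proof.
case: s => [|x s] //= a_s.
(* Strengthened for induction on the tail after [x]: only the class not containing [x] can be ahead
   there, and by at most one. *)
suff: count a s <= count (predC a) s + ~~ a x /\
      count (predC a) s <= count a s + a x by case: (a x) => /=; lia.
elim: s x a_s => [|y s IHs] x //= /andP[axy /IHs].
by move: axy; case: (a x); case: (a y) => /=; lia.
Qed.

(** Otherwise [p] vertices from each set span a forbidden biclique; disjointness supplies the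
    [x != y] required by [compl_adj]. *)
Lemma no_hole (p : nat) (G : sgraph) (X Y : {set G}) :
    ~ subgraph (biclique p p) (compl_graph G) ->
    [disjoint X & Y] -> {in X & Y, forall x y, ~~ adj x y} ->
  #|X| < p \/ #|Y| < p.
Proof.
move=> noKpp disXY noXY; case: (ltnP #|X| p) => [|leX]; first by left.
case: (ltnP #|Y| p) => [|leY]; first by right.
case: noKpp.
pose fX (i : 'I_p) : G := enum_val (widen_ord leX i).
pose fY (i : 'I_p) : G := enum_val (widen_ord leY i).
have XfX i : fX i \in X by apply: enum_valP.
have YfY i : fY i \in Y by apply: enum_valP.
have neqXY i j : fX i != fY j.
  by apply: contraTneq (YfY j) => <-; rewrite (disjointFr disXY (XfX i)).
exists (fun z : biclique p p => match z with inl i => fX i | inr j => fY j end).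
split.
- move=> [i|i] [j|j] eq_f.
  + by move/enum_val_inj/(congr1 val): eq_f => /= /val_inj->.
  + by move/eqP: eq_f; rewrite (negPf (neqXY _ _)).
  + by move/esym/eqP: eq_f; rewrite (negPf (neqXY _ _)).
  + by move/enum_val_inj/(congr1 val): eq_f => /= /val_inj->.
- move=> [i|i] [j|j] //= _; rewrite /compl_adj.
  + by rewrite neqXY noXY.
  + by rewrite eq_sym neqXY adj_sym noXY.
Qed.

Section TwoColors.
Variables (p : nat) (G : sgraph) (c : edge_coloring2 G).
Hypothesis noKpp : ~ subgraph (biclique p p) (compl_graph G).

Let mono (k : bool) : rel G := fun x y => adj x y && (c [set x; y] == k).

Let mono_sym k : symmetric (mono k).
Proof. by move=> x y; rewrite /mono adj_sym setUC. Qed.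

Lemma bipartite_monochromatic_path (k : bool) (A B : {set G}) :
    [disjoint A & B] -> #|A| = #|B| ->
    {in A & B, forall x y, ~~ mono (~~ k) x y} ->
  exists s, [/\ monochromatic_path c k s, {subset s <= A :|: B}
              & #|A| + #|B| <= size s + 4 * p].
Proof.
move=> disAB cardAB noAB.
(* Keeping only the edges between [A] and [B] forces the stack to alternate between the sides. *)
pose cross (x y : G) :=
  (x \in A) && (y \in B) || (x \in B) && (y \in A).
pose e x y := mono k x y && cross x y.
have e_sym : symmetric e.
  move=> x y; rewrite /e mono_sym /cross orbC.
  by congr (_ && (_ || _)); apply: andbC.
have [s [D [U [st cardDU]]]] := balanced_dfs e_sym (A :|: B).
have [Us Es part noDU] := st.
have BNA x : x \in B -> x \in A = false by move=> Bx; apply: disjointFl disAB Bx.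
have side x : x \in A :|: B -> (x \in B) = (x \notin A).
  by case/setUP => [Ax|Bx]; [rewrite Ax (disjointFr disAB Ax) | rewrite Bx BNA].
(* Across the sides only color [k] occurs, so pairs not joined by [e] are non-edges of [G], as
   [no_hole] needs. *)
have adj_e x y : x \in A -> y \in B -> adj x y -> e x y.
  move=> Ax By xy; have := noAB x y Ax By.
  by rewrite /e /mono /cross xy Ax By /=; case: (c _); case: (k).
have subD x : x \in D -> x \in A :|: B by move=> Dx; have := part x; lia.
have subU x : x \in U -> x \in A :|: B by move=> Ux; have := part x; lia.
have alt : sorted (fun x y => (x \in A) != (y \in A)) s.
  apply: sub_sorted Es => x y /andP[_ /orP[]/andP[]].
    by move=> -> /BNA->.
  by move=> /BNA-> ->.
have [altA altB] := alternating_count alt.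
pose inA (X : {set G}) := [set x in X | x \in A].
pose outA (X : {set G}) := [set x in X | x \notin A].
have cardA : #|A| = count [in A] s + #|inA D| + #|inA U|.
  rewrite -(dfs_card [in A] st); apply: eq_card => x.
  by rewrite !inE /=; case: (x \in A); rewrite ?andbF.
have cardB : #|B| = count [predC A] s + #|outA D| + #|outA U|.
  rewrite -(dfs_card [predC A] st); apply: eq_card => x; rewrite !inE.
  by have := @BNA x; case: (x \in B) => [->//|_]; case: (x \in A).
have split_card (X : {set G}) : #|X| = #|inA X| + #|outA X|.
  rewrite -(cardsID A X); congr (_ + _); apply: eq_card => x; rewrite !inE //.
  by rewrite andbC.
have hole1 : #|inA D| < p \/ #|outA U| < p.
  apply: no_hole noKpp _ _.
    apply/pred0P => x /=; rewrite !inE.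
    by case: (x \in A); rewrite ?andbF.
  move=> x y; rewrite !inE => /andP[Dx Ax] /andP[Uy yNA].
  apply: contra (noDU x y Dx Uy); apply: adj_e => //.
  by rewrite side ?subU.
have hole2 : #|outA D| < p \/ #|inA U| < p.
  apply: no_hole noKpp _ _.
    apply/pred0P => x /=; rewrite !inE.
    by case: (x \in A); rewrite ?andbF.
  move=> x y; rewrite !inE => /andP[Dx xNA] /andP[Uy Ay].
  apply: contra (noDU x y Dx Uy); rewrite adj_sym e_sym; apply: adj_e => //.
  by rewrite side ?subD.
exists s; split.
- by rewrite /monochromatic_path Us; apply: sub_sorted Es => x y /andP[].
- by move=> x sx; have := part x; rewrite sx; case: (x \in _ :|: _) => //; lia.
(* Since [#|A| = #|B|] and [#|D| = #|U|], twice the difference of [#|inA D|] and [#|outA U|] is, up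
   to sign, that of the two counts on [s]. Being at most one, it vanishes; likewise
   [#|outA D| = #|inA U|]. Hence all four are below [p]. *)
- have := count_predC [in A] s; have := split_card D; have := split_card U.
  lia.
Qed.

Lemma two_monochromatic_paths :
  exists s1 s2, [/\ monochromatic_path c true s1, monochromatic_path c false s2,
    [disjoint s1 & s2] & #|G| <= #|[set x in s1 ++ s2]| + 4 * p].
Proof.
have [s1 [A [B [st cardAB]]]] := balanced_dfs (mono_sym true) setT.
have [Us1 Es1 part noAB] := st.
have disAB : [disjoint A & B].
  by apply/pred0P => x /=; have := part x; rewrite inE; lia.
(* The sets left by the red search have no red edge across, so blue, [k := false], fits; [s2] stays
   inside them and so avoids [s1]. *)
have [s2 [path2 sub2 size2]] :=
  bipartite_monochromatic_path (k := false) disAB cardAB noAB.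
have dis12 : [disjoint s1 & s2].
  apply/pred0P => x /=; apply/negP => /andP[s1x /sub2/setUP AB].
  by have := part x; rewrite s1x inE; lia.
exists s1, s2; split=> //; first by rewrite /monochromatic_path Us1.
have Us12 : uniq (s1 ++ s2).
  rewrite cat_uniq Us1 -disjoint_has disjoint_sym dis12 /=.
  by case/andP: path2.
rewrite cardsE (card_uniqP Us12) size_cat.
have := dfs_card predT st; rewrite count_predT.
have setE (X : {set G}) : [set x in X | predT x] = X.
  by apply/setP => x; rewrite inE andbT.
rewrite !setE cardsT; lia.
Qed.

End TwoColors.

Theorem theorem24 (p n : nat) (G : sgraph) (p_gt0 : 0 < p)
    (card_G : #|G| = n) (noKpp : ~ subgraph (biclique p p) (compl_graph G))
    (c : edge_coloring2 G) :
  exists (k1 k2 : bool) (s1 s2 : seq G),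
    [/\ k1 != k2, monochromatic_path c k1 s1, monochromatic_path c k2 s2, [disjoint s1 & s2]
      & n <= #|[set x in s1 ++ s2]| + 1000 * (50 * p) ^ p].
Proof.
have [s1 [s2 [path1 path2 dis12 cover]]] := two_monochromatic_paths c noKpp.
exists true, false, s1, s2; split=> //; rewrite -card_G.
apply: leq_trans cover _; rewrite leq_add2l.
(* Since [p] is positive, the exponent is at least one, so the linear loss [4 * p] is within the
   allowance. *)
have le_exp : 50 * p <= (50 * p) ^ p.
  by rewrite -{1}(expn1 (50 * p)) leq_pexp2l //; lia.
apply: (@leq_trans (1000 * (50 * p))); first by lia.
by rewrite leq_mul2l le_exp.
Qed.
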